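(* Let $\mathbf{A}$ be a perfect pseudo MV-algebra. Then $\mathbf{A}\cong\mathcal{K}(\ell(\mathbf{F}_{\mathbf{A}}),\ell^{\approx})$.
   Context: A residuated lattice is an algebra $(A;\wedge,\vee,\cdot,\backslash,/,1)$ that is a lattice and a monoid with $y\le x\backslash z\iff xy\le z\iff x\le z/y$. An FL$_w$-algebra is a residuated lattice with an additional constant $0$ such that $1$ is the greatest and $0$ the least element; write $x^-:=0/x$ and $x^{\sim}:=x\backslash 0$. A pseudo MV-algebra is an FL$_w$-algebra satisfying $x/(y\backslash x)=x\vee y=(x/y)\backslash x$. An FL$_w$-algebra $\mathbf{A}$ is perfect if there is a homomorphism $h_{\mathbf{A}}\colon\mathbf{A}\to\mathbf{2}$ onto the two-element Boolean algebra (as an FL$_w$-algebra) such that $x\le y$ whenever $h_{\mathbf{A}}(x)=0$ and $h_{\mathbf{A}}(y)=1$ (this $h_{\mathbf A}$ is unique); put $F_{\mathbf{A}}=h_{\mathbf{A}}^{-1}(1)$ and $J_{\mathbf{A}}=h_{\mathbf{A}}^{-1}(0)$. For an $\ell$-group $\mathbf{L}$ with unit $e$, let $L^-=\{x: x\le e\}$, $L^+=\{x:x\ge e\}$. The negative cone $\mathbf{L}^-$ is the integral residuated lattice on $L^-$ with $\wedge,\vee,\cdot,e$ inherited and $x/y:=xy^{-1}\wedge e$, $y\backslash x:=y^{-1}x\wedge e$. The variety $\mathsf{CanIGMV}$ consists of integral residuated lattices satisfying $xy/y=x=y\backslash yx$ and $x/(y\backslash x)=x\vee y=(x/y)\backslash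 x$; its members are precisely the negative cones of $\ell$-groups. The functor $\mathbf{L}\mapsto\mathbf{L}^-$ is an equivalence from $\ell$-groups to $\mathsf{CanIGMV}$ (homomorphisms restrict to negative cones), and $\ell\colon\mathsf{CanIGMV}\to\mathsf{LG}$ is its quasi-inverse, with $\ell(\mathbf{A})^-=\mathbf{A}$. If $\mathbf{A}$ is a perfect pseudo MV-algebra, $\mathbf{F}_{\mathbf{A}}$ denotes the subalgebra with universe $F_{\mathbf{A}}$ of the $0$-free reduct of $\mathbf{A}$; it is a member of $\mathsf{CanIGMV}$. The map $x\mapsto x^{\sim\sim}$ is an automorphism of $\mathbf{F}_{\mathbf{A}}$, and $\ell^{\approx}:=\ell((-)^{\sim\sim})$ is the induced automorphism of $\ell(\mathbf{F}_{\mathbf{A}})$. For an $\ell$-group $\mathbf{L}$ and an automorphism $\lambda$ of $\mathbf{L}$, $\mathcal{K}(\mathbf{L},\lambda)=(L^-\uplus L^+;\wedge,\vee,\odot,\backslash,/,0,1)$ (disjoint union), where $0:=e\in L^+$, $1:=e\in L^-$, every element of $L^+$ lies below every element of $L^-$, the lattice operations on each of $L^-$, $L^+$ are those of $\mathbf{L}$, and: - $x\odot y$ is: $xy\in L^-$ if $x,y\in L^-$; $\lambda(x)y\vee e\in L^+$ if $x\in L^-,y\in L^+$; $xy\vee e\in L^+$ if $x\in L^+,y\in L^-$; $e\in L^+$ if $x,y\in L^+$. - $x\backslash y$ is: $x^{-1}y\wedge e\in L^-$ if $x,y\in L^-$; $e\in L^-$ if $x\in L^+,y\in L^-$; $\lambda(x)^{-1}y\vee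 e\in L^+$ if $x\in L^-,y\in L^+$; $x^{-1}y\wedge e\in L^-$ if $x,y\in L^+$. - $y/x$ is: $yx^{-1}\wedge e\in L^-$ if $x,y\in L^-$; $e\in L^-$ if $x\in L^+,y\in L^-$; $yx^{-1}\vee e\in L^+$ if $x\in L^-,y\in L^+$; $\lambda^{-1}(yx^{-1})\wedge e\in L^-$ if $x,y\in L^+$. *)

(* Defs.v *)
From Stdlib Require Import ssreflect ssrfun ssrbool Setoid ProofIrrelevance.

Set Implicit Arguments.
Unset Strict Implicit.
Unset Printing Implicit Defensive.

(* Carriers are arbitrary types and equality is Leibniz equality.  Each class
   of algebras is split into a signature ("_ops") and a predicate ("is_") for
   its axioms. *)

Record lat_ops := LatOps {
  lat_sort :> Type;
  meet : lat_sort -> lat_sort -> lat_sort;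
  join : lat_sort -> lat_sort -> lat_sort }.

Definition le (A : lat_ops) (x y : A) : Prop := meet x y = x.

Declare Scope lat_scope.
Open Scope lat_scope.
Notation "x ⊓ y" := (meet x y) (at level 48, left associativity) : lat_scope.
Notation "x ⊔ y" := (join x y) (at level 49, left associativity) : lat_scope.
Notation "x ⊑ y" := (le x y) (at level 70, no associativity) : lat_scope.

Record is_lattice (A : lat_ops) : Prop := IsLattice {
  meetC : forall x y : A, x ⊓ y = y ⊓ x;
  joinC : forall x y : A, x ⊔ y = y ⊔ x;
  meetA : forall x y z : A, x ⊓ (y ⊓ z) = (x ⊓ y) ⊓ z;
  joinA : forall x y z : A, x ⊔ (y ⊔ z) = (x ⊔ y) ⊔ z;
  joinKI : forall x y : A, x ⊓ (x ⊔ y) = x;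
  meetKU : forall x y : A, x ⊔ (x ⊓ y) = x }.

Record rl_ops := RlOps {
  rl_lat :> lat_ops;
  mul : rl_lat -> rl_lat -> rl_lat;
  ldiv : rl_lat -> rl_lat -> rl_lat;
  rdiv : rl_lat -> rl_lat -> rl_lat;
  one : rl_lat }.

Declare Scope rl_scope.
Delimit Scope rl_scope with rl.
Open Scope rl_scope.
Notation "x ⋅ y" := (mul x y) (at level 40, left associativity) : rl_scope.
Notation "x \ y" := (ldiv x y) (at level 40, left associativity) : rl_scope.
Notation "x / y" := (rdiv x y) (at level 40, left associativity) : rl_scope.
Notation "1" := (one _) : rl_scope.

Record is_residuated_lattice (M : rl_ops) : Prop := IsResiduatedLattice {
  rl_lattice : is_lattice M;
  mulA : forall x y z : M, x ⋅ (y ⋅ z) = (x ⋅ y) ⋅ z;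
  mul1x : forall x : M, 1 ⋅ x = x;
  mulx1 : forall x : M, x ⋅ 1 = x;
  ldivP : forall x y z : M, y ⊑ x \ z <-> x ⋅ y ⊑ z;
  rdivP : forall x y z : M, x ⋅ y ⊑ z <-> x ⊑ z / y }.

Record is_integral (M : rl_ops) : Prop := IsIntegral {
  int_rl : is_residuated_lattice M;
  le_one : forall x : M, x ⊑ 1 }.

Record is_CanIGMV (M : rl_ops) : Prop := IsCanIGMV {
  can_int : is_integral M;
  can_r : forall x y : M, (x ⋅ y) / y = x;
  can_l : forall x y : M, y \ (y ⋅ x) = x;
  can_gmv_l : forall x y : M, x / (y \ x) = x ⊔ y;
  can_gmv_r : forall x y : M, (x / y) \ x = x ⊔ y }.

Record canIGMV := CanIGMV {
  can_ops :> rl_ops;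
  canP : is_CanIGMV can_ops }.

Record is_rl_hom (M N : rl_ops) (f : M -> N) : Prop := IsRlHom {
  rl_hom_meet : forall x y, f (x ⊓ y) = f x ⊓ f y;
  rl_hom_join : forall x y, f (x ⊔ y) = f x ⊔ f y;
  rl_hom_mul : forall x y, f (x ⋅ y) = f x ⋅ f y;
  rl_hom_ldiv : forall x y, f (x \ y) = f x \ f y;
  rl_hom_rdiv : forall x y, f (x / y) = f x / f y;
  rl_hom_one : f 1 = 1 }.

Record rl_hom (M N : rl_ops) := RlHom {
  rl_fun :> M -> N;
  rl_funP : is_rl_hom rl_fun }.

Lemma rl_id_subproof (M : rl_ops) : is_rl_hom (@id M).
Proof. by []. Qed.

Definition rl_id (M : rl_ops) : rl_hom M M := RlHom (rl_id_subproof M).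

Lemma rl_comp_subproof (M N P : rl_ops) (g : rl_hom N P) (f : rl_hom M N) :
  is_rl_hom (g \o f).
Proof.
case: f g => [f [f1 f2 f3 f4 f5 f6]] [g [g1 g2 g3 g4 g5 g6]].
by split=> * /=; rewrite ?(f1, f2, f3, f4, f5, f6) ?(g1, g2, g3, g4, g5, g6).
Qed.

Definition rl_comp (M N P : rl_ops) (g : rl_hom N P) (f : rl_hom M N) :
  rl_hom M P := RlHom (rl_comp_subproof g f).

Record rl_iso (M N : rl_ops) := RlIso {
  rl_fwd :> rl_hom M N;
  rl_bwd : rl_hom N M;
  rl_fwdK : cancel rl_fwd rl_bwd;
  rl_bwdK : cancel rl_bwd rl_fwd }.

Record fl_ops := FlOps {
  fl_rl :> rl_ops;
  zero : fl_rl }.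

Notation "0" := (zero _) : rl_scope.

Record is_FLw (A : fl_ops) : Prop := IsFLw {
  flw_int : is_integral A;
  le_zero : forall x : A, (0 : A) ⊑ x }.

Definition minus (A : fl_ops) (x : A) : A := 0 / x.
Definition tilde (A : fl_ops) (x : A) : A := x \ 0.

Record is_pseudo_MV (A : fl_ops) : Prop := IsPseudoMV {
  pmv_flw : is_FLw A;
  pmv_gmv_l : forall x y : A, x / (y \ x) = x ⊔ y;
  pmv_gmv_r : forall x y : A, (x / y) \ x = x ⊔ y }.

Definition is_fl_hom (A B : fl_ops) (f : A -> B) : Prop :=
  is_rl_hom f /\ f 0 = 0.

Definition fl_isomorphic (A B : fl_ops) : Prop :=
  exists f : A -> B, is_fl_hom f /\ bijective f.

Definition two : fl_ops :=
  @FlOps (@RlOps (@LatOps bool andb orb)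
            andb (fun x y => x ==> y) (fun y x => x ==> y) true) false.

(* The map is unique when it exists, so it may be carried as data. *)
Record perfect (A : fl_ops) := Perfect {
  perfect_map : A -> bool;
  perfect_hom : @is_fl_hom A two perfect_map;
  perfect_onto : forall b, exists x, perfect_map x = b;
  perfect_le : forall x y : A,
    perfect_map x = false -> perfect_map y = true -> x ⊑ y }.

Record perfect_pMV := PerfectPMV {
  ppmv_ops :> fl_ops;
  ppmvP : is_pseudo_MV ppmv_ops;
  ppmv_perfect : perfect ppmv_ops }.

Definition h (A : perfect_pMV) : A -> bool := perfect_map (ppmv_perfect A).
Arguments h A x : clear implicits.

Record lg_ops := LgOps {
  lg_lat :> lat_ops;
  gmul : lg_lat -> lg_lat -> lg_lat;
  ginv : lg_lat -> lg_lat;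
  gone : lg_lat }.

Declare Scope lg_scope.
Delimit Scope lg_scope with lg.
Notation "x * y" := (gmul x y) (at level 40, left associativity) : lg_scope.
Notation "x ^-1" := (ginv x) (at level 3, left associativity, format "x ^-1")
  : lg_scope.
Notation "'e'" := (gone _) : lg_scope.

Record is_lgroup (L : lg_ops) : Prop := IsLgroup {
  lg_lattice : is_lattice L;
  gmulA : forall x y z : L, (x * (y * z) = (x * y) * z)%lg;
  gmul1x : forall x : L, (e * x = x)%lg;
  gmulx1 : forall x : L, (x * e = x)%lg;
  gmulVx : forall x : L, (x^-1 * x = e)%lg;
  gmulxV : forall x : L, (x * x^-1 = e)%lg;
  gmul_le_l : forall x y z : L, x ⊑ y -> (z * x ⊑ z * y)%lg;
  gmul_le_r : forall x y z : L, x ⊑ y -> (x * z ⊑ y * z)%lg }.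

Record lgroup := Lgroup {
  lg_car :> lg_ops;
  lgP : is_lgroup lg_car }.

Record is_lg_hom (L K : lg_ops) (f : L -> K) : Prop := IsLgHom {
  lg_hom_meet : forall x y, f (x ⊓ y) = f x ⊓ f y;
  lg_hom_join : forall x y, f (x ⊔ y) = f x ⊔ f y;
  lg_hom_mul : forall x y, (f (x * y) = f x * f y)%lg;
  lg_hom_inv : forall x, (f (x^-1) = (f x)^-1)%lg;
  lg_hom_one : (f e = e)%lg }.

Record lg_hom (L K : lg_ops) := LgHom {
  lg_fun :> L -> K;
  lg_funP : is_lg_hom lg_fun }.

Lemma lg_id_subproof (L : lg_ops) : is_lg_hom (@id L).
Proof. by []. Qed.

Definition lg_id (L : lg_ops) : lg_hom L L := LgHom (lg_id_subproof L).

Lemma lg_comp_subproof (L K P : lg_ops) (g : lg_hom K P) (f : lg_hom L K) :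
  is_lg_hom (g \o f).
Proof.
case: f g => [f [f1 f2 f3 f4 f5]] [g [g1 g2 g3 g4 g5]].
by split=> * /=; rewrite ?(f1, f2, f3, f4, f5) ?(g1, g2, g3, g4, g5).
Qed.

Definition lg_comp (L K P : lg_ops) (g : lg_hom K P) (f : lg_hom L K) :
  lg_hom L P := LgHom (lg_comp_subproof g f).

Record lg_iso (L K : lg_ops) := LgIso {
  lg_fwd :> lg_hom L K;
  lg_bwd : lg_hom K L;
  lg_fwdK : cancel lg_fwd lg_bwd;
  lg_bwdK : cancel lg_bwd lg_fwd }.

Lemma sub_inj (T : Type) (P : T -> Prop) (u v : {x | P x}) :
  proj1_sig u = proj1_sig v -> u = v.
Proof.
by case: u v => [x px] [y py] /= E; subst y; rewrite (proof_irrelevance _ px py).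
Qed.

Section Lattice.
Context {A : lat_ops} (HA : is_lattice A).
Implicit Types x y z : A.

Lemma le_refl x : x ⊑ x.
Proof. by rewrite /le -{2}(meetKU HA x x) (joinKI HA). Qed.

Lemma le_trans y x z : x ⊑ y -> y ⊑ z -> x ⊑ z.
Proof. by rewrite /le => xy yz; rewrite -xy -(meetA HA) yz. Qed.

Lemma le_anti x y : x ⊑ y -> y ⊑ x -> x = y.
Proof. by rewrite /le => xy yx; rewrite -xy (meetC HA) yx. Qed.

Lemma leIl x y : x ⊓ y ⊑ x.
Proof. by rewrite /le (meetC HA) (meetA HA) (le_refl x). Qed.

Lemma leIr x y : x ⊓ y ⊑ y.
Proof. by rewrite (meetC HA); apply: leIl. Qed.

Lemma lexI x y z : z ⊑ x -> z ⊑ y -> z ⊑ x ⊓ y.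
Proof. by rewrite /le (meetA HA) => -> ->. Qed.

Lemma leUl x y : x ⊑ x ⊔ y.
Proof. by rewrite /le (joinKI HA). Qed.

Lemma leUr x y : y ⊑ x ⊔ y.
Proof. by rewrite (joinC HA); apply: leUl. Qed.

Lemma le_joinP x y : x ⊑ y <-> x ⊔ y = y.
Proof.
split=> [<-|<-]; last exact: leUl.
by rewrite (joinC HA) (meetC HA) (meetKU HA).
Qed.

Lemma join_xx x : x ⊔ x = x.
Proof. exact/le_joinP/le_refl. Qed.

Lemma leUx x y z : x ⊑ z -> y ⊑ z -> x ⊔ y ⊑ z.
Proof.
by move=> /le_joinP xz /le_joinP yz; apply/le_joinP; rewrite -(joinA HA) yz xz.
Qed.

Lemma leU2 x y z t : x ⊑ z -> y ⊑ t -> x ⊔ y ⊑ z ⊔ t.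
Proof.
move=> xz yt; apply: leUx; first by apply: le_trans xz (leUl _ _).
by apply: le_trans yt (leUr _ _).
Qed.

Lemma leI2 x y z t : x ⊑ z -> y ⊑ t -> x ⊓ y ⊑ z ⊓ t.
Proof.
move=> xz yt; apply: lexI; first by apply: le_trans (leIl _ _) xz.
by apply: le_trans (leIr _ _) yt.
Qed.

End Lattice.

Lemma order_iso_meet_join (A B : lat_ops) (f : A -> B) (g : B -> A) :
  is_lattice A -> is_lattice B -> cancel f g -> cancel g f ->
  (forall x y, x ⊑ y -> f x ⊑ f y) -> (forall x y, x ⊑ y -> g x ⊑ g y) ->
  (forall x y, f (x ⊓ y) = f x ⊓ f y) /\ (forall x y, f (x ⊔ y) = f x ⊔ f y).
Proof.
move=> HA HB fK gK f_le g_le; split=> x y; apply: (le_anti HB).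
- by apply: (lexI HB); apply: f_le; [apply: leIl | apply: leIr].
- rewrite -[X in X ⊑ _]gK; apply: f_le; apply: (lexI HA).
    by rewrite -[X in _ ⊑ X]fK; apply: g_le; apply: leIl.
  by rewrite -[X in _ ⊑ X]fK; apply: g_le; apply: leIr.
- rewrite -[X in _ ⊑ X]gK; apply: f_le; apply: (leUx HA).
    by rewrite -[X in X ⊑ _]fK; apply: g_le; apply: leUl.
  by rewrite -[X in X ⊑ _]fK; apply: g_le; apply: leUr.
- by apply: (leUx HB); apply: f_le; [apply: leUl | apply: leUr].
Qed.

Lemma order_iso_rl_hom (M N : rl_ops) (f : M -> N) (g : N -> M) :
  is_residuated_lattice M -> is_residuated_lattice N ->
  cancel f g -> cancel g f ->
  (forall x y, x ⊑ y -> f x ⊑ f y) -> (forall x y, x ⊑ y -> g x ⊑ g y) ->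
  (forall x y, f (x ⋅ y) = f x ⋅ f y) -> is_rl_hom f.
Proof.
move=> HM HN fK gK f_le g_le fM.
have [LM LN] := (rl_lattice HM, rl_lattice HN).
have gM x y : g (x ⋅ y) = g x ⋅ g y by rewrite -[RHS]fK fM !gK.
have [fI fU] := order_iso_meet_join LM LN fK gK f_le g_le.
split=> // [x y|x y|].
- apply: (le_anti LN).
    by apply/(ldivP HN); rewrite -fM; apply: f_le; apply/(ldivP HM)/(le_refl LM).
  rewrite -[X in X ⊑ _]gK; apply/f_le/(ldivP HM).
  rewrite -{1}[x]fK -gM -[X in _ ⊑ X]fK; apply/g_le/(ldivP HN)/(le_refl LN).
- apply: (le_anti LN).
    by apply/(rdivP HN); rewrite -fM; apply: f_le; apply/(rdivP HM)/(le_refl LM).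
  rewrite -[X in X ⊑ _]gK; apply/f_le/(rdivP HM).
  rewrite -{2}[y]fK -gM -[X in _ ⊑ X]fK; apply/g_le/(rdivP HN)/(le_refl LN).
- by rewrite -[f 1](mulx1 HN) -[X in _ ⋅ X]gK -fM (mul1x HM) gK.
Qed.

Lemma rl_hom_le (M N : rl_ops) (f : rl_hom M N) x y : x ⊑ y -> f x ⊑ f y.
Proof. by rewrite /le -(rl_hom_meet (rl_funP f)) => ->. Qed.

Definition op_rl (M : rl_ops) : rl_ops :=
  @RlOps M (fun x y => y ⋅ x) (fun x y => y / x) (fun x y => y \ x) 1.

Section Residuated.
Context {M : rl_ops} (HM : is_residuated_lattice M).
Let LM := rl_lattice HM.
Implicit Types x y z : M.

Lemma op_residuated : is_residuated_lattice (op_rl M).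
Proof.
split=> //= [x y z|x|x|x y z|x y z].
- by rewrite (mulA HM).
- exact: (mulx1 HM).
- exact: (mul1x HM).
- exact: iff_sym (rdivP HM _ _ _).
- exact: iff_sym (ldivP HM _ _ _).
Qed.

Lemma mul_ldiv x y : x ⋅ (x \ y) ⊑ y.
Proof. exact/(ldivP HM)/(le_refl LM). Qed.

Lemma mul_rdiv x y : (y / x) ⋅ x ⊑ y.
Proof. exact/(rdivP HM)/(le_refl LM). Qed.

Lemma mul_le_l x y z : x ⊑ y -> z ⋅ x ⊑ z ⋅ y.
Proof.
move=> xy; apply/(ldivP HM); apply: (le_trans LM) xy _.
by apply/(ldivP HM)/(le_refl LM).
Qed.

Lemma mul_le_r x y z : x ⊑ y -> x ⋅ z ⊑ y ⋅ z.
Proof.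
move=> xy; apply/(rdivP HM); apply: (le_trans LM) xy _.
by apply/(rdivP HM)/(le_refl LM).
Qed.

Lemma ldiv_le x y z : x ⊑ y -> z \ x ⊑ z \ y.
Proof. by move=> xy; apply/(ldivP HM); apply: (le_trans LM) (mul_ldiv _ _) xy. Qed.

Lemma rdiv_le x y z : x ⊑ y -> x / z ⊑ y / z.
Proof. by move=> xy; apply/(rdivP HM); apply: (le_trans LM) (mul_rdiv _ _) xy. Qed.

Lemma ldiv_anti x y z : x ⊑ y -> y \ z ⊑ x \ z.
Proof.
move=> xy; apply/(ldivP HM); apply: (le_trans LM) (mul_ldiv y z).
exact: mul_le_r.
Qed.

Lemma rdiv_anti x y z : x ⊑ y -> z / y ⊑ z / x.
Proof.
move=> xy; apply/(rdivP HM); apply: (le_trans LM) (mul_rdiv y z).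
exact: mul_le_l.
Qed.

Lemma le_ext x y : (forall z, z ⊑ x <-> z ⊑ y) -> x = y.
Proof. by move=> E; apply: (le_anti LM); apply/E/(le_refl LM). Qed.

Lemma ldiv_rdiv x y z : x \ (y / z) = (x \ y) / z.
Proof.
apply: le_ext => t; rewrite (ldivP HM) -!(rdivP HM) (ldivP HM).
by rewrite (mulA HM).
Qed.

Lemma ldiv_mul x y z : (x ⋅ y) \ z = y \ (x \ z).
Proof. by apply: le_ext => t; rewrite !(ldivP HM) (mulA HM). Qed.

Lemma rdiv_mul x y z : z / (x ⋅ y) = (z / y) / x.
Proof. by apply: le_ext => t; rewrite -!(rdivP HM) (mulA HM). Qed.

Lemma mulUl x y z : (x ⊔ y) ⋅ z = x ⋅ z ⊔ y ⋅ z.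
Proof.
apply: (le_anti LM); last first.
  by apply: (leUx LM); apply: mul_le_r; [apply: leUl | apply: leUr].
by apply/(rdivP HM); apply: (leUx LM); apply/(rdivP HM);
  [apply: leUl | apply: leUr].
Qed.

Lemma rdivU x y z : z / (x ⊔ y) = z / x ⊓ z / y.
Proof.
apply: (le_anti LM).
  by apply: (lexI LM); apply: rdiv_anti; [apply: leUl | apply: leUr].
apply/(rdivP HM)/(ldivP HM).
by apply: (leUx LM); apply/(ldivP HM)/(rdivP HM); [apply: leIl | apply: leIr].
Qed.

End Residuated.

Record is_igmv (M : rl_ops) : Prop := IsIgmv {
  igmv_int : is_integral M;
  gmv_l : forall x y : M, x / (y \ x) = x ⊔ y;
  gmv_r : forall x y : M, (x / y) \ x = x ⊔ y }.

Lemma op_igmv (M : rl_ops) : is_igmv M -> is_igmv (op_rl M).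
Proof.
case=> -[R I] Hl Hr; split=> //.
by split=> //; apply: op_residuated.
Qed.

Lemma CanIGMV_igmv (M : rl_ops) : is_CanIGMV M -> is_igmv M.
Proof. by case. Qed.

Lemma op_CanIGMV (M : rl_ops) : is_CanIGMV M -> is_CanIGMV (op_rl M).
Proof.
move=> HM; have [? ? ?] := op_igmv (CanIGMV_igmv HM).
by split=> //= x y; [apply: (can_l HM) | apply: (can_r HM)].
Qed.

Section Igmv.
Context {M : rl_ops} (HM : is_igmv M).
Let RM := int_rl (igmv_int HM).
Let LM := rl_lattice RM.
Let le1 := le_one (igmv_int HM).
Implicit Types x y z : M.

Lemma ldiv_eq1 x y : x ⊑ y -> x \ y = 1.
Proof.
by move=> xy; apply: (le_anti LM) (le1 _) _; apply/(ldivP RM); rewrite (mulx1 RM).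
Qed.

Lemma rdiv_eq1 x y : x ⊑ y -> y / x = 1.
Proof.
by move=> xy; apply: (le_anti LM) (le1 _) _; apply/(rdivP RM); rewrite (mul1x RM).
Qed.

Lemma ldiv1x x : 1 \ x = x.
Proof. by apply: (le_ext RM) => t; rewrite (ldivP RM) (mul1x RM). Qed.

Lemma rdivx1 x : x / 1 = x.
Proof. by apply: (le_ext RM) => t; rewrite -(rdivP RM) (mulx1 RM). Qed.

Lemma mul_lel x y : x ⋅ y ⊑ x.
Proof. by rewrite -[X in _ ⊑ X](mulx1 RM); apply: (mul_le_l RM). Qed.

Lemma mul_ler x y : x ⋅ y ⊑ y.
Proof. by rewrite -[X in _ ⊑ X](mul1x RM); apply: (mul_le_r RM). Qed.

Lemma div_le_l x y : y ⊑ x -> x ⋅ (x \ y) = y.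
Proof.
move=> yx; set w := x ⋅ (x \ y).
have wy : w ⊑ y by apply: (mul_ldiv RM).
have xw : x \ w = x \ y.
  apply: (le_anti LM); first exact: (ldiv_le RM).
  by apply/(ldivP RM)/(le_refl LM).
have yw : w / (y \ w) = y by rewrite (gmv_l HM); apply/(le_joinP LM).
have uc : (x \ w) / (y \ w) = x \ w by rewrite -(ldiv_rdiv RM) yw xw.
have uLc : x \ w ⊑ y \ w by apply: (ldiv_anti RM).
have c1 : y \ w = 1.
  have := gmv_r HM (x \ w) (y \ w).
  by rewrite uc (ldiv_eq1 (le_refl LM _)) (proj1 (le_joinP LM _ _) uLc).
apply: (le_anti LM) wy _.
by rewrite -[X in X ⊑ _](mulx1 RM) -c1; apply: (mul_ldiv RM).
Qed.

Lemma ldiv_meet x y : x \ (x ⊓ y) = x \ y.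
Proof.
apply: (le_anti LM); first by apply: (ldiv_le RM); apply: leIr.
apply/(ldivP RM)/(lexI LM); [exact: mul_lel | exact: (mul_ldiv RM)].
Qed.

Lemma div_l x y : x ⋅ (x \ y) = x ⊓ y.
Proof. by rewrite -ldiv_meet; apply/div_le_l/(leIl LM). Qed.

End Igmv.

Lemma div_r (M : rl_ops) (HM : is_igmv M) (x y : M) : (y / x) ⋅ x = x ⊓ y.
Proof. exact: (div_l (op_igmv HM)). Qed.

Section LgTheory.
Local Open Scope lg_scope.
Context {L : lg_ops} (HL : is_lgroup L).
Let LL := lg_lattice HL.
Implicit Types x y z : L.

Lemma gmulKV x y : x * (x^-1 * y) = y.
Proof. by rewrite (gmulA HL) (gmulxV HL) (gmul1x HL). Qed.

Lemma gmulVK x y : x^-1 * (x * y) = y.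
Proof. by rewrite (gmulA HL) (gmulVx HL) (gmul1x HL). Qed.

Lemma gmulK x y : x * y * y^-1 = x.
Proof. by rewrite -(gmulA HL) (gmulxV HL) (gmulx1 HL). Qed.

Lemma gmulKv x y : x * y^-1 * y = x.
Proof. by rewrite -(gmulA HL) (gmulVx HL) (gmulx1 HL). Qed.

Lemma ginv_uniq x y : x * y = e -> y = x^-1.
Proof. by move=> E; rewrite -(gmulVK x y) E (gmulx1 HL). Qed.

Lemma ginvK x : x^-1^-1 = x.
Proof. by apply/esym/ginv_uniq; rewrite (gmulVx HL). Qed.

Lemma ginvM x y : (x * y)^-1 = y^-1 * x^-1.
Proof.
by apply/esym/ginv_uniq; rewrite (gmulA HL) gmulK (gmulxV HL).
Qed.

Lemma ginv1 : (e : L)^-1 = e.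
Proof. by apply/esym/ginv_uniq; rewrite (gmulx1 HL). Qed.

Lemma gle_divl x y z : y ⊑ x^-1 * z <-> x * y ⊑ z.
Proof.
split=> /(gmul_le_l HL); first by move/(_ x); rewrite gmulKV.
by move/(_ x^-1); rewrite gmulVK.
Qed.

Lemma gle_divr x y z : x ⊑ z * y^-1 <-> x * y ⊑ z.
Proof.
split=> /(gmul_le_r HL); first by move/(_ y); rewrite gmulKv.
by move/(_ y^-1); rewrite gmulK.
Qed.

Lemma ginv_le x y : x ⊑ y -> y^-1 ⊑ x^-1.
Proof.
move=> xy; rewrite -[x^-1](gmulx1 HL); apply/gle_divl.
by apply/gle_divr; rewrite (gmul1x HL) ginvK.
Qed.
Lemma gmulUr x y z : z * (x ⊔ y) = z * x ⊔ z * y.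
Proof.
apply: (le_anti LL); last first.
  by apply: (leUx LL); apply: (gmul_le_l HL); [apply: leUl | apply: leUr].
rewrite -[X in _ ⊑ X](gmulKV z); apply: (gmul_le_l HL).
by apply: (leUx LL); apply/gle_divl; [apply: leUl | apply: leUr].
Qed.

Lemma gmulUl x y z : (x ⊔ y) * z = x * z ⊔ y * z.
Proof.
apply: (le_anti LL); last first.
  by apply: (leUx LL); apply: (gmul_le_r HL); [apply: leUl | apply: leUr].
rewrite -[X in _ ⊑ X](gmulKv _ z); apply: (gmul_le_r HL).
by apply: (leUx LL); apply/gle_divr; [apply: leUl | apply: leUr].
Qed.

Lemma gmulIl x y z : (x ⊓ y) * z = x * z ⊓ y * z.
Proof.
apply: (le_anti LL).
  by apply: (lexI LL); apply: (gmul_le_r HL); [apply: leIl | apply: leIr].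
rewrite -[X in X ⊑ _](gmulKv _ z); apply: (gmul_le_r HL).
apply: (lexI LL); rewrite -[X in _ ⊑ X](gmulK _ z); apply: (gmul_le_r HL);
  [exact: leIl | exact: leIr].
Qed.

Lemma ginvI x y : (x ⊓ y)^-1 = x^-1 ⊔ y^-1.
Proof.
apply: (le_anti LL); last first.
  by apply: (leUx LL); apply: ginv_le; [apply: leIl | apply: leIr].
rewrite -[X in _ ⊑ X]ginvK; apply: ginv_le; apply: (lexI LL).
  by rewrite -[X in _ ⊑ X]ginvK; apply/ginv_le/(leUl LL).
by rewrite -[X in _ ⊑ X]ginvK; apply/ginv_le/(leUr LL).
Qed.

Lemma neg_part x : (x ⊓ e) * (x^-1 ⊓ e)^-1 = x.
Proof.
have E : x ⊓ e = x * (x^-1 ⊓ e).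
  apply: (le_anti LL).
    by rewrite -[X in X ⊑ _](gmulKV x); apply: (gmul_le_l HL);
      apply: (lexI LL); apply/gle_divl; rewrite ?(gmulVx HL) ?(gmulx1 HL) ?ginvK;
      [apply: leIr | apply: leIl].
  apply: (lexI LL).
    by rewrite -[X in _ ⊑ X](gmulx1 HL); apply/(gmul_le_l HL)/(leIr LL).
  by rewrite -(gmulxV HL x); apply/(gmul_le_l HL)/(leIl LL).
by rewrite {1}E gmulK.
Qed.

Lemma meet_e_le x : x ⊓ e ⊑ e. Proof. exact: (leIr LL). Qed.
Lemma join_e_le x : e ⊑ x ⊔ e. Proof. exact: (leUr LL). Qed.

Lemma neg_meet x y : x ⊑ e -> y ⊑ e -> x ⊓ y ⊑ e.
Proof. by move=> xe _; apply: (le_trans LL) (leIl LL _ _) xe. Qed.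

Lemma neg_join x y : x ⊑ e -> y ⊑ e -> x ⊔ y ⊑ e.
Proof. exact: (leUx LL). Qed.

Lemma neg_mul x y : x ⊑ e -> y ⊑ e -> x * y ⊑ e.
Proof.
move=> xe ye; rewrite -(gmulx1 HL e); apply: (le_trans LL) (gmul_le_r HL y xe) _.
exact: (gmul_le_l HL).
Qed.

Lemma pos_meet x y : e ⊑ x -> e ⊑ y -> e ⊑ x ⊓ y.
Proof. exact: (lexI LL). Qed.

Lemma pos_join x y : e ⊑ x -> e ⊑ y -> e ⊑ x ⊔ y.
Proof. by move=> xe _; apply: (le_trans LL) xe (leUl LL _ _). Qed.
End LgTheory.

Section NegCone.
Local Open Scope lg_scope.
Context (L : lgroup).
Let HL := lgP L.
Let LL := lg_lattice HL.

Definition neg := {x : L | x ⊑ e}.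
Definition pos := {x : L | e ⊑ x}.

Definition neg_part_of (x : L) : neg := exist _ (x ⊓ e) (meet_e_le HL x).
Definition pos_part_of (x : L) : pos := exist _ (x ⊔ e) (join_e_le HL x).

Definition negI (x y : neg) : neg :=
  exist _ (proj1_sig x ⊓ proj1_sig y) (neg_meet HL (proj2_sig x) (proj2_sig y)).
Definition negU (x y : neg) : neg :=
  exist _ (proj1_sig x ⊔ proj1_sig y) (neg_join HL (proj2_sig x) (proj2_sig y)).
Definition negM (x y : neg) : neg :=
  exist _ (proj1_sig x * proj1_sig y) (neg_mul HL (proj2_sig x) (proj2_sig y)).
Definition neg1 : neg := exist (fun x => x ⊑ e) e (le_refl LL e).
Definition posI (x y : pos) : pos :=
  exist _ (proj1_sig x ⊓ proj1_sig y) (pos_meet HL (proj2_sig x) (proj2_sig y)).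
Definition posU (x y : pos) : pos :=
  exist _ (proj1_sig x ⊔ proj1_sig y) (pos_join HL (proj2_sig x) (proj2_sig y)).
Definition pos1 : pos := exist (fun x => e ⊑ x) e (le_refl LL e).

Definition neg_rl : rl_ops :=
  @RlOps (@LatOps neg negI negU) negM
    (fun y x => neg_part_of ((proj1_sig y)^-1 * proj1_sig x))
    (fun x y => neg_part_of (proj1_sig x * (proj1_sig y)^-1))
    neg1.

Lemma neg_leP (x y : neg_rl) : x ⊑ y <-> proj1_sig x ⊑ proj1_sig y.
Proof.
split; first by rewrite {2}/le => {2}<-.
by move=> xy; apply: sub_inj.
Qed.

Lemma neg_CanIGMV : is_CanIGMV neg_rl.
Proof.
split.
- split; last by move=> [x xe]; apply/neg_leP.
  split.
  + split=> * /=; apply: sub_inj => /=.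
    * exact: (meetC LL).
    * exact: (joinC LL).
    * exact: (meetA LL).
    * exact: (joinA LL).
    * exact: (joinKI LL).
    * exact: (meetKU LL).
  + by move=> *; apply: sub_inj; apply: (gmulA HL).
  + by move=> *; apply: sub_inj; apply: (gmul1x HL).
  + by move=> *; apply: sub_inj; apply: (gmulx1 HL).
  + move=> [x xe] [y ye] [z ze]; rewrite !neg_leP /=; split=> [le1|le1].
      by apply/(gle_divl HL)/(le_trans LL le1)/(leIl LL).
    by apply: (lexI LL) ye; apply/(gle_divl HL).
  + move=> [x xe] [y ye] [z ze]; rewrite !neg_leP /=; split=> [le1|le1].
      by apply: (lexI LL) xe; apply/(gle_divr HL).
    by apply/(gle_divr HL)/(le_trans LL le1)/(leIl LL).
- by move=> [x xe] [y ye]; apply: sub_inj; rewrite /= (gmulK HL).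
- by move=> [x xe] [y ye]; apply: sub_inj; rewrite /= (gmulVK HL).
- move=> [x xe] [y ye]; apply: sub_inj => /=.
  rewrite (ginvI HL) (ginvM HL) (ginvK HL) (ginv1 HL) (gmulUr HL) (gmulKV HL).
  by rewrite (gmulx1 HL) (joinC LL y); apply: (leUx LL).
- move=> [x xe] [y ye]; apply: sub_inj => /=.
  rewrite (ginvI HL) (ginvM HL) (ginvK HL) (ginv1 HL) (gmulUl HL) (gmulKv HL).
  by rewrite (gmul1x HL) (joinC LL y); apply: (leUx LL).
Qed.

Definition neg_cone : canIGMV := CanIGMV neg_CanIGMV.

End NegCone.

Section NegMap.
Context (L K : lgroup) (f : lg_hom L K).
Let Hf := lg_funP f.

Lemma neg_map_le (x : L) : x ⊑ gone _ -> f x ⊑ gone _.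
Proof. by rewrite /le -(lg_hom_one Hf) -(lg_hom_meet Hf) => ->. Qed.

Definition neg_map_fun (x : neg_cone L) : neg_cone K :=
  exist _ (f (proj1_sig x)) (neg_map_le (proj2_sig x)).

Lemma neg_map_subproof : is_rl_hom neg_map_fun.
Proof.
split=> [x y|x y|x y|x y|x y|]; apply: sub_inj => /=.
- exact: (lg_hom_meet Hf).
- exact: (lg_hom_join Hf).
- exact: (lg_hom_mul Hf).
- by rewrite (lg_hom_meet Hf) (lg_hom_mul Hf) (lg_hom_inv Hf) (lg_hom_one Hf).
- by rewrite (lg_hom_meet Hf) (lg_hom_mul Hf) (lg_hom_inv Hf) (lg_hom_one Hf).
- exact: (lg_hom_one Hf).
Qed.

Definition neg_map : rl_hom (neg_cone L) (neg_cone K) := RlHom neg_map_subproof.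

End NegMap.

(* A functor CanIGMV -> LG (homomorphisms are compared pointwise) that is
   quasi-inverse to L |-> L^-.  The convention ell(M)^- = M is the isomorphism
   ell_unit.  Such a functor is determined up to natural isomorphism, and
   frac_quasi_inverse below is one. *)
Record quasi_inverse := QuasiInverse {
  ell :> canIGMV -> lgroup;
  ell_map : forall M N : canIGMV, rl_hom M N -> lg_hom (ell M) (ell N);
  ell_map_ext : forall (M N : canIGMV) (f g : rl_hom M N),
    f =1 g -> ell_map f =1 ell_map g;
  ell_map_id : forall M : canIGMV, ell_map (rl_id M) =1 lg_id (ell M);
  ell_map_comp : forall (M N P : canIGMV) (g : rl_hom N P) (f : rl_hom M N),
    ell_map (rl_comp g f) =1 lg_comp (ell_map g) (ell_map f);
  ell_unit : forall M : canIGMV, rl_iso M (neg_cone (ell M));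
  ell_unit_nat : forall (M N : canIGMV) (f : rl_hom M N) (x : M),
    ell_unit N (f x) = neg_map (ell_map f) (ell_unit M x);
  ell_counit : forall L : lgroup, lg_iso (ell (neg_cone L)) L;
  ell_counit_nat : forall (L K : lgroup) (f : lg_hom L K) (x : ell (neg_cone L)),
    ell_counit K (ell_map (neg_map f) x) = f (ell_counit L x) }.

Arguments ell_map q {M N} f.
Arguments ell_map_ext q {M N f g} fg x.
Arguments ell_map_id q M x : clear implicits.
Arguments ell_map_comp q {M N P} g f x.

Section EllIso.
Context (E : quasi_inverse) (M N : canIGMV) (f : rl_iso M N).

Lemma ell_iso_fwdK : cancel (ell_map E f) (ell_map E (rl_bwd f)).
Proof.
move=> x; have := ell_map_comp E (rl_bwd f) f x.
rewrite /= => <-; rewrite -[RHS](ell_map_id E M x).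
by apply: (ell_map_ext E) => y /=; apply: rl_fwdK.
Qed.

Lemma ell_iso_bwdK : cancel (ell_map E (rl_bwd f)) (ell_map E f).
Proof.
move=> x; have := ell_map_comp E f (rl_bwd f) x.
rewrite /= => <-; rewrite -[RHS](ell_map_id E N x).
by apply: (ell_map_ext E) => y /=; apply: rl_bwdK.
Qed.

Definition ell_iso : lg_iso (E M) (E N) := LgIso ell_iso_fwdK ell_iso_bwdK.

End EllIso.

Section PseudoMV.
Context {A : fl_ops} (HA : is_pseudo_MV A).
Implicit Types x y z : A.

Lemma pmv_igmv : is_igmv A.
Proof. by case: HA => -[? ?] ? ?. Qed.
Let RA := int_rl (igmv_int pmv_igmv).
Let LA := rl_lattice RA.

Lemma tildeK x : minus (tilde x) = x.
Proof.
rewrite /minus /tilde (pmv_gmv_l HA); apply/(le_joinP LA).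
exact: (le_zero (pmv_flw HA)).
Qed.

Lemma minusK x : tilde (minus x) = x.
Proof.
rewrite /minus /tilde (pmv_gmv_r HA); apply/(le_joinP LA).
exact: (le_zero (pmv_flw HA)).
Qed.

Lemma tilde_anti x y : x ⊑ y -> tilde y ⊑ tilde x.
Proof. exact: (ldiv_anti RA). Qed.

Lemma minus_anti x y : x ⊑ y -> minus y ⊑ minus x.
Proof. exact: (rdiv_anti RA). Qed.

Lemma ldiv_tilde x y : x \ y = tilde x / tilde y.
Proof. by rewrite -{1}[y]tildeK /minus (ldiv_rdiv RA). Qed.

Lemma tilde_rdiv x y : tilde (x / y) = y ⋅ tilde x.
Proof. by rewrite -{1}[x]tildeK /minus -(rdiv_mul RA) minusK. Qed.

Lemma tilde_mul x y : tilde (x ⋅ y) = y \ tilde x.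
Proof. exact: (ldiv_mul RA). Qed.

Lemma tilde2_mul x y : tilde (tilde (x ⋅ y)) = tilde (tilde x) ⋅ tilde (tilde y).
Proof. by rewrite tilde_mul ldiv_tilde tilde_rdiv. Qed.

Lemma ldivK_perfect (P : perfect A) x y :
  perfect_map P x = true -> perfect_map P y = true -> y \ (y ⋅ x) = x.
Proof.
move=> Fx Fy; rewrite -[y ⋅ x]tildeK /minus (ldiv_rdiv RA) tilde_mul.
rewrite (pmv_gmv_l HA) (joinC LA (y \ 0) x) (joinC LA).
apply/(le_joinP LA); apply: (perfect_le (p := P)) => //.
have [Hh H0] := perfect_hom P.
by rewrite (rl_hom_ldiv Hh) Fy H0.
Qed.

End PseudoMV.

Definition op_fl (A : fl_ops) : fl_ops := @FlOps (op_rl A) 0.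

Lemma op_pseudo_MV (A : fl_ops) : is_pseudo_MV A -> is_pseudo_MV (op_fl A).
Proof.
move=> HA; have [I Hl Hr] := op_igmv (pmv_igmv HA).
by split=> //; split=> //; apply: (le_zero (pmv_flw HA)).
Qed.

Definition op_perfect (A : fl_ops) (P : perfect A) : perfect (op_fl A).
Proof.
refine (@Perfect (op_fl A) (perfect_map P) _ (perfect_onto P) (@perfect_le A P)).
have [[hI hU hM hl hr h1] h0] := perfect_hom P.
split=> //; split=> //= x y.
by rewrite hM /= andbC.
Defined.

Section Filter.
Context (A : perfect_pMV).
Let HA := ppmvP A.
Let RA := int_rl (igmv_int (pmv_igmv HA)).
Let LA := rl_lattice RA.
Let hA := h A.

Lemma h_rl : @is_rl_hom A two hA.
Proof. by case: (perfect_hom (ppmv_perfect A)). Qed.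

Lemma h_zero : hA 0 = false.
Proof. by case: (perfect_hom (ppmv_perfect A)). Qed.

Definition filter := {x : A | hA x = true}.

Lemma filterI x y : hA x = true -> hA y = true -> hA (x ⊓ y) = true.
Proof. by rewrite (rl_hom_meet h_rl) => -> ->. Qed.

Lemma filterU x y : hA x = true -> hA y = true -> hA (x ⊔ y) = true.
Proof. by rewrite (rl_hom_join h_rl) => -> ->. Qed.

Lemma filterM x y : hA x = true -> hA y = true -> hA (x ⋅ y) = true.
Proof. by rewrite (rl_hom_mul h_rl) => -> ->. Qed.

Lemma filter_ldiv x y : hA x = true -> hA y = true -> hA (x \ y) = true.
Proof. by rewrite (rl_hom_ldiv h_rl) => -> ->. Qed.

Lemma filter_rdiv x y : hA x = true -> hA y = true -> hA (x / y) = true.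
Proof. by rewrite (rl_hom_rdiv h_rl) => -> ->. Qed.

Definition filter_lift (op : A -> A -> A)
    (opF : forall x y, hA x = true -> hA y = true -> hA (op x y) = true)
    (x y : filter) : filter :=
  exist _ (op (proj1_sig x) (proj1_sig y)) (opF _ _ (proj2_sig x) (proj2_sig y)).

Definition filter_rl : rl_ops :=
  @RlOps (@LatOps filter (filter_lift filterI) (filter_lift filterU))
    (filter_lift filterM) (filter_lift filter_ldiv) (filter_lift filter_rdiv)
    (exist _ 1 (rl_hom_one h_rl)).

Lemma filter_leP (x y : filter_rl) : x ⊑ y <-> proj1_sig x ⊑ proj1_sig y.
Proof.
split; first by rewrite {2}/le => {2}<-.
by move=> xy; apply: sub_inj.
Qed.

Lemma filter_CanIGMV : is_CanIGMV filter_rl.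
Proof.
split.
- split; last by move=> x; apply/filter_leP/(le_one (igmv_int (pmv_igmv HA))).
  split.
  + split=> * /=; apply: sub_inj => /=.
    * exact: (meetC LA).
    * exact: (joinC LA).
    * exact: (meetA LA).
    * exact: (joinA LA).
    * exact: (joinKI LA).
    * exact: (meetKU LA).
  + by move=> *; apply: sub_inj; apply: (mulA RA).
  + by move=> *; apply: sub_inj; apply: (mul1x RA).
  + by move=> *; apply: sub_inj; apply: (mulx1 RA).
  + by move=> x y z; rewrite !filter_leP; apply: (ldivP RA).
  + by move=> x y z; rewrite !filter_leP; apply: (rdivP RA).
- move=> [x Fx] [y Fy]; apply: sub_inj => /=.
  exact: (ldivK_perfect (op_pseudo_MV HA) (P := op_perfect (ppmv_perfect A))).
- move=> [x Fx] [y Fy]; apply: sub_inj => /=.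
  exact: (ldivK_perfect HA (P := ppmv_perfect A)).
- by move=> *; apply: sub_inj; apply: (pmv_gmv_l HA).
- by move=> *; apply: sub_inj; apply: (pmv_gmv_r HA).
Qed.

Definition F : canIGMV := CanIGMV filter_CanIGMV.

Lemma filter_tilde2 x : hA x = true -> hA (tilde (tilde x)) = true.
Proof. by rewrite /tilde !(rl_hom_ldiv h_rl) h_zero => ->. Qed.

Lemma filter_minus2 x : hA x = true -> hA (minus (minus x)) = true.
Proof. by rewrite /minus !(rl_hom_rdiv h_rl) h_zero => ->. Qed.

Definition tilde2_fun (x : F) : F :=
  exist _ (tilde (tilde (proj1_sig x))) (filter_tilde2 (proj2_sig x)).

Definition minus2_fun (x : F) : F :=
  exist _ (minus (minus (proj1_sig x))) (filter_minus2 (proj2_sig x)).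

Lemma tilde2_funK : cancel tilde2_fun minus2_fun.
Proof. by move=> x; apply: sub_inj; rewrite /= !(tildeK HA). Qed.

Lemma minus2_funK : cancel minus2_fun tilde2_fun.
Proof. by move=> x; apply: sub_inj; rewrite /= !(minusK HA). Qed.

Lemma tilde2_le (x y : F) : x ⊑ y -> tilde2_fun x ⊑ tilde2_fun y.
Proof. by rewrite !filter_leP => xy; do 2!apply: (tilde_anti HA). Qed.

Lemma minus2_le (x y : F) : x ⊑ y -> minus2_fun x ⊑ minus2_fun y.
Proof. by rewrite !filter_leP => xy; do 2!apply: (minus_anti HA). Qed.

Lemma tilde2_funM (x y : F) : tilde2_fun (x ⋅ y) = tilde2_fun x ⋅ tilde2_fun y.
Proof. by apply: sub_inj; apply: (tilde2_mul HA). Qed.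

Let RF := int_rl (can_int (canP F)).

Lemma tilde2_subproof : is_rl_hom tilde2_fun.
Proof.
exact: (order_iso_rl_hom RF RF tilde2_funK minus2_funK tilde2_le minus2_le
         tilde2_funM).
Qed.

Lemma minus2_subproof : is_rl_hom minus2_fun.
Proof.
apply: (order_iso_rl_hom RF RF minus2_funK tilde2_funK minus2_le tilde2_le).
by move=> x y; rewrite -[RHS]tilde2_funK tilde2_funM !minus2_funK.
Qed.

Definition tilde2 : rl_iso F F :=
  @RlIso F F (RlHom tilde2_subproof) (RlHom minus2_subproof)
    tilde2_funK minus2_funK.

End Filter.

Definition ell_approx (E : quasi_inverse) (A : perfect_pMV) :
  lg_iso (E (F A)) (E (F A)) := ell_iso E (tilde2 A).

Section KConstruction.
Local Open Scope lg_scope.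
Context (L : lgroup) (lam : lg_iso L L).

(* inl is the copy of L^- and inr is the copy of L^+. *)
Definition K_carrier : Type := (neg L + pos L)%type.

Definition K_meet (x y : K_carrier) : K_carrier :=
  match x, y with
  | inl x, inl y => inl (negI x y)
  | inl x, inr y => inr y
  | inr x, inl y => inr x
  | inr x, inr y => inr (posI x y)
  end.

Definition K_join (x y : K_carrier) : K_carrier :=
  match x, y with
  | inl x, inl y => inl (negU x y)
  | inl x, inr y => inl x
  | inr x, inl y => inl y
  | inr x, inr y => inr (posU x y)
  end.

Definition K_mul (x y : K_carrier) : K_carrier :=
  match x, y with
  | inl x, inl y => inl (negM x y)
  | inl x, inr y => inr (pos_part_of (lam (proj1_sig x) * proj1_sig y))
  | inr x, inl y => inr (pos_part_of (proj1_sig x * proj1_sig y))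
  | inr x, inr y => inr (pos1 L)
  end.

Definition K_ldiv (x y : K_carrier) : K_carrier :=
  match x, y with
  | inl x, inl y => inl (neg_part_of ((proj1_sig x)^-1 * proj1_sig y))
  | inr x, inl y => inl (neg1 L)
  | inl x, inr y => inr (pos_part_of ((lam (proj1_sig x))^-1 * proj1_sig y))
  | inr x, inr y => inl (neg_part_of ((proj1_sig x)^-1 * proj1_sig y))
  end.

(* The numerator comes first: K_rdiv y x is y / x. *)
Definition K_rdiv (y x : K_carrier) : K_carrier :=
  match x, y with
  | inl x, inl y => inl (neg_part_of (proj1_sig y * (proj1_sig x)^-1))
  | inr x, inl y => inl (neg1 L)
  | inl x, inr y => inr (pos_part_of (proj1_sig y * (proj1_sig x)^-1))
  | inr x, inr y =>
      inl (neg_part_of (lg_bwd lam (proj1_sig y * (proj1_sig x)^-1)))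
  end.

Definition K : fl_ops :=
  @FlOps (@RlOps (@LatOps K_carrier K_meet K_join) K_mul K_ldiv K_rdiv
            (inl (neg1 L)))
    (inr (pos1 L)).

End KConstruction.

Arguments K L lam : clear implicits.

(* ell(M) is the group of fractions of M.  Every fraction x y^-1 has a unique
   representative a b^-1 with a ⊔ b = 1, namely a = x / y and b = y / x, and
   ell(M) is built on these representatives. *)

Section Fractions.
Context (M : canIGMV).
Let CM := canP M.
Let GM := CanIGMV_igmv CM.
Let OM := op_igmv GM.
Let RM := int_rl (can_int CM).
Let LM := rl_lattice RM.
Let le1 := le_one (can_int CM).
Implicit Types x y z u v s a b : M.

Lemma orth_mul x y z : x ⊔ y = 1 -> x ⊔ z = 1 -> x ⊔ y ⋅ z = 1.
Proof.
move=> xy xz; apply: (le_anti LM) (le1 _) _.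
rewrite -[X in X ⊑ _](mul1x RM) -[X in X ⋅ _]xy (mulUl RM).
apply: (leUx LM); first by apply: (le_trans LM) (mul_lel GM _ _) (leUl LM _ _).
rewrite -xz; apply/(ldivP RM)/(leUx LM); apply/(ldivP RM).
  by apply: (le_trans LM) (mul_ler GM _ _) (leUl LM _ _).
exact: (leUr LM).
Qed.

Definition frac := {p : M * M | fst p ⊔ snd p = 1}.
Definition num (p : frac) : M := fst (proj1_sig p).
Definition den (p : frac) : M := snd (proj1_sig p).

Lemma fracP (p : frac) : num p ⊔ den p = 1.
Proof. exact: proj2_sig p. Qed.

Lemma frac_eq (p q : frac) : num p = num q -> den p = den q -> p = q.
Proof.
case: p q => [[a b] ab] [[c d] cd]; rewrite /num /den /= => E1 E2.
by apply: sub_inj; rewrite /= E1 E2.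
Qed.

Lemma rdiv_join x y : (x / y) ⋅ (x ⊔ y) = x.
Proof.
have -> : x / y = x / (x ⊔ y).
  rewrite (rdivU RM) (rdiv_eq1 GM (le_refl LM x)) (meetC LM).
  exact: esym (le1 _).
rewrite (div_r GM) (meetC LM); exact: (leUl LM).
Qed.

Lemma rdiv_orth x y : (x / y) ⊔ (y / x) = 1.
Proof.
have E : ((x / y) ⊔ (y / x)) ⋅ (x ⊔ y) = 1 ⋅ (x ⊔ y).
  by rewrite (mulUl RM) rdiv_join [in y / x ⋅ _](joinC LM) rdiv_join (mul1x RM).
by rewrite -(can_r CM (_ ⊔ _) (x ⊔ y)) E (can_r CM).
Qed.

Definition norm x y : frac := exist _ (x / y, y / x) (rdiv_orth x y).

Lemma orth_rdiv a b : a ⊔ b = 1 -> a / b = a.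
Proof.
move=> ab; apply: (le_anti LM).
  rewrite -{2}(rdivx1 GM a) -ab (rdivU RM); apply: (lexI LM) (le_refl LM _).
  by rewrite (rdiv_eq1 GM (le_refl LM a)).
by apply/(rdivP RM)/(mul_lel GM).
Qed.

Lemma norm_frac (p : frac) : norm (num p) (den p) = p.
Proof.
have pP := fracP p; apply: frac_eq; rewrite /norm /num /den /=.
  exact: orth_rdiv.
by apply: orth_rdiv; rewrite (joinC LM).
Qed.

Lemma norm_orth a b (ab : a ⊔ b = 1) : norm a b = exist _ (a, b) ab.
Proof. exact: (norm_frac (exist _ (a, b) ab)). Qed.

Lemma norm_scale x y s : norm (x ⋅ s) (y ⋅ s) = norm x y.
Proof.
by apply: frac_eq; rewrite /norm /num /den /= (rdiv_mul RM) (can_r CM).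
Qed.

Lemma norm_decomp x y : exists s,
  x = num (norm x y) ⋅ s /\ y = den (norm x y) ⋅ s.
Proof.
exists (x ⊔ y); rewrite /norm /num /den /= rdiv_join; split=> //.
by rewrite (joinC LM) rdiv_join.
Qed.

Definition fmul (p q : frac) : frac :=
  norm (num p ⋅ (den p \ num q)) (den q ⋅ (num q \ den p)).

Lemma fmul_frac (p q : frac) u v :
  den p ⋅ u = num q ⋅ v -> fmul p q = norm (num p ⋅ u) (den q ⋅ v).
Proof.
set b := den p; set c := num q => E.
have le_bc : b ⋅ u ⊑ b ⊓ c.
  apply: (lexI LM); first exact: (mul_lel GM).
  by rewrite E; apply: (mul_lel GM).
set r := (b ⊓ c) \ (b ⋅ u).
have Er : (b ⊓ c) ⋅ r = b ⋅ u by apply: (div_le_l GM).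
have Eu : u = (b \ c) ⋅ r.
  by rewrite -(can_l CM u b) -Er -(div_l GM) -(mulA RM) (can_l CM).
have Ev : v = (c \ b) ⋅ r.
  by rewrite -(can_l CM v c) -E -Er (meetC LM) -(div_l GM) -(mulA RM) (can_l CM).
by rewrite Eu Ev !(mulA RM) norm_scale.
Qed.

Lemma fmul_norm x y z w u v :
  y ⋅ u = z ⋅ v -> fmul (norm x y) (norm z w) = norm (x ⋅ u) (w ⋅ v).
Proof.
have [s [Ex Ey]] := norm_decomp x y; have [t [Ez Ew]] := norm_decomp z w.
rewrite {1}Ey {1}Ez -!(mulA RM) => /fmul_frac ->.
by rewrite {2}Ex {2}Ew -!(mulA RM).
Qed.

Lemma ore y z : exists u v, y ⋅ u = z ⋅ v.
Proof. by exists (y \ z), (z \ y); rewrite !(div_l GM) (meetC LM). Qed.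

Lemma fmulA p q r : fmul p (fmul q r) = fmul (fmul p q) r.
Proof.
rewrite -(norm_frac p) -(norm_frac q) -(norm_frac r).
move: (num p) (den p) (num q) (den q) (num r) (den r) => a b c d g k.
have [u [v Euv]] := ore b c; have [m [n Emn]] := ore (d ⋅ v) g.
rewrite (fmul_norm a d Euv) (fmul_norm _ _ Emn).
have E1 : d ⋅ (v ⋅ m) = g ⋅ n by rewrite (mulA RM).
rewrite (fmul_norm c k E1).
have E2 : b ⋅ (u ⋅ m) = c ⋅ (v ⋅ m) ⋅ 1.
  by rewrite (mulx1 RM) !(mulA RM) Euv.
by rewrite (fmul_norm a _ E2) (mulx1 RM) (mulA RM).
Qed.

Definition fone : frac := exist _ (1, 1) (join_xx LM 1).

Definition finv (p : frac) : frac :=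
  exist _ (den p, num p) (etrans (joinC LM _ _) (fracP p)).

Lemma frac_meet_subproof a b c d :
  a ⊔ b = 1 -> c ⊔ d = 1 -> (a ⊓ c) ⊔ (b ⊔ d) = 1.
Proof.
move=> ab cd; have bda : b ⊔ d ⊔ a = 1.
  apply: (le_anti LM) (le1 _) _; rewrite -ab (joinC LM a).
  by apply: (leU2 LM) (leUl LM _ _) (le_refl LM _).
have bdc : b ⊔ d ⊔ c = 1.
  apply: (le_anti LM) (le1 _) _; rewrite -cd (joinC LM c).
  by apply: (leU2 LM) (leUr LM _ _) (le_refl LM _).
apply: (le_anti LM) (le1 _) _; rewrite -(orth_mul bda bdc) (joinC LM (a ⊓ c)).
apply: (leU2 LM) (le_refl LM _) _; apply: (lexI LM);
  [exact: (mul_lel GM) | exact: (mul_ler GM)].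
Qed.

Lemma frac_join_subproof a b c d :
  a ⊔ b = 1 -> c ⊔ d = 1 -> (a ⊔ c) ⊔ (b ⊓ d) = 1.
Proof.
rewrite (joinC LM a b) (joinC LM c d) (joinC LM (a ⊔ c)).
exact: frac_meet_subproof.
Qed.

Definition fmeet (p q : frac) : frac :=
  exist _ (num p ⊓ num q, den p ⊔ den q)
    (frac_meet_subproof (fracP p) (fracP q)).

Definition fjoin (p q : frac) : frac :=
  exist _ (num p ⊔ num q, den p ⊓ den q)
    (frac_join_subproof (fracP p) (fracP q)).

Definition frac_ops : lg_ops :=
  @LgOps (@LatOps frac fmeet fjoin) fmul finv fone.

Lemma frac_leP (p q : frac_ops) :
  p ⊑ q <-> num p ⊑ num q /\ den q ⊑ den p.
Proof.
split=> [pq|[n d]].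
  have {}pq : fmeet p q = p := pq; split.
    exact: (congr1 num pq).
  by apply/(le_joinP LM); rewrite (joinC LM); apply: (congr1 den pq).
apply: frac_eq => //=; rewrite -[RHS](proj1 (le_joinP LM _ _) d).
exact: (joinC LM).
Qed.

Lemma frac_lattice : is_lattice frac_ops.
Proof.
split=> * /=; apply: frac_eq; rewrite /num /den /=;
  [exact: (meetC LM) | exact: (joinC LM) | exact: (joinC LM)
  |exact: (meetC LM) | exact: (meetA LM) | exact: (joinA LM)
  |exact: (joinA LM) | exact: (meetA LM) | exact: (joinKI LM)
  |exact: (meetKU LM) | exact: (meetKU LM) | exact: (joinKI LM)].
Qed.

Lemma norm_1 : norm 1 1 = fone.
Proof. exact: (norm_frac fone). Qed.

Lemma norm_xx x : norm x x = fone.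
Proof. by rewrite -norm_1 -{1 2}(mul1x RM x) norm_scale. Qed.

Lemma finv_norm (p : frac) : finv p = norm (den p) (num p).
Proof. exact: esym (norm_frac (finv p)). Qed.

Lemma frac_common_den (p q : frac_ops) : p ⊑ q ->
  exists x y z, [/\ p = norm x y, q = norm z y & x ⊑ z].
Proof.
move=> /frac_leP [pq qp].
exists (num p ⋅ (den p \ den q)), (den q), (num q); split.
- by rewrite -{2}(div_le_l GM qp) norm_scale norm_frac.
- by rewrite norm_frac.
- by apply: (le_trans LM) pq; apply: (mul_lel GM).
Qed.

Lemma frac_common_num (p q : frac_ops) : p ⊑ q ->
  exists x y w, [/\ p = norm x y, q = norm x w & w ⊑ y].
Proof.
move=> /frac_leP [pq qp].
exists (num p), (den p), (den q ⋅ (num q \ num p)); split.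
- by rewrite norm_frac.
- by rewrite -{1}(div_le_l GM pq) norm_scale norm_frac.
- by apply: (le_trans LM) qp; apply: (mul_lel GM).
Qed.

Lemma norm_le x y z w : x ⊑ z -> w ⊑ y -> le (norm x y : frac_ops) (norm z w).
Proof.
move=> xz wy; apply/frac_leP; rewrite /norm /num /den /=; split.
  by apply: (le_trans LM) (rdiv_le RM _ xz) (rdiv_anti RM _ wy).
by apply: (le_trans LM) (rdiv_le RM _ wy) (rdiv_anti RM _ xz).
Qed.

Lemma frac_lgroup : is_lgroup frac_ops.
Proof.
split.
- exact: frac_lattice.
- exact: fmulA.
- move=> p; rewrite /= -(norm_frac p) -norm_1.
  have E : 1 ⋅ num p = num p ⋅ 1 by rewrite (mul1x RM) (mulx1 RM).
  by rewrite (fmul_norm _ _ E) (mul1x RM) (mulx1 RM).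
- move=> p; rewrite /= -(norm_frac p) -norm_1.
  have E : den p ⋅ 1 = 1 ⋅ den p by rewrite (mul1x RM) (mulx1 RM).
  by rewrite (fmul_norm _ _ E) (mul1x RM) (mulx1 RM).
- move=> p; have := fmul_norm (den p) (den p) (erefl (num p ⋅ 1)).
  by rewrite -finv_norm norm_frac norm_xx.
- move=> p; have := fmul_norm (num p) (num p) (erefl (den p ⋅ 1)).
  by rewrite -finv_norm norm_frac norm_xx.
- move=> p q r /frac_common_num [x [y [w [-> -> wy]]]] /=.
  rewrite -(norm_frac r); have [u [v E]] := ore (den r) x.
  rewrite !(fmul_norm _ _ E); apply: norm_le; first exact: (le_refl LM).
  exact: (mul_le_r RM).
- move=> p q r /frac_common_den [x [y [z [-> -> xz]]]] /=.
  rewrite -(norm_frac r); have [u [v E]] := ore y (num r).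
  rewrite !(fmul_norm _ _ E); apply: norm_le; last exact: (le_refl LM).
  exact: (mul_le_r RM).
Qed.

Definition frac_group : lgroup := Lgroup frac_lgroup.

Lemma join1 x : x ⊔ 1 = 1.
Proof. exact/(le_joinP LM). Qed.

Definition frac_unit_fun (x : M) : neg_cone frac_group.
Proof.
exists (exist (fun p : M * M => fst p ⊔ snd p = 1) (x, 1) (join1 x)).
apply/frac_leP; split; [exact: le1 | exact: (le_refl LM)].
Defined.

Definition frac_unit_inv (p : neg_cone frac_group) : M := num (proj1_sig p).

Lemma frac_unitK : cancel frac_unit_fun frac_unit_inv.
Proof. by []. Qed.

Lemma frac_unit_invK : cancel frac_unit_inv frac_unit_fun.
Proof.
move=> [p p1]; apply: sub_inj; apply: frac_eq => //=.
have [_ ?] := proj1 (frac_leP p fone) p1.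
by apply: (le_anti LM) => //; apply: le1.
Qed.

Lemma frac_unit_le x y : x ⊑ y -> frac_unit_fun x ⊑ frac_unit_fun y.
Proof.
by move=> xy; apply/neg_leP/frac_leP; split=> //; apply: (le_refl LM).
Qed.

Lemma frac_unit_inv_le (p q : neg_cone frac_group) :
  p ⊑ q -> frac_unit_inv p ⊑ frac_unit_inv q.
Proof. by move=> /neg_leP /frac_leP []. Qed.

Lemma norm_x1 x : norm x 1 = proj1_sig (frac_unit_fun x).
Proof. exact: norm_orth. Qed.

Lemma frac_unitM x y : frac_unit_fun (x ⋅ y) = frac_unit_fun x ⋅ frac_unit_fun y.
Proof.
apply: sub_inj; transitivity (fmul (norm x 1) (norm y 1)); last first.
  by rewrite !norm_x1.
have E : 1 ⋅ y = y ⋅ 1 by rewrite (mul1x RM) (mulx1 RM).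
by rewrite (fmul_norm _ _ E) (mul1x RM) norm_x1.
Qed.

Let RN := int_rl (can_int (canP (neg_cone frac_group))).

Lemma frac_unit_subproof : is_rl_hom frac_unit_fun.
Proof.
exact: (order_iso_rl_hom RM RN frac_unitK frac_unit_invK frac_unit_le
  frac_unit_inv_le frac_unitM).
Qed.

Lemma frac_unit_inv_subproof : is_rl_hom frac_unit_inv.
Proof.
apply: (order_iso_rl_hom RN RM frac_unit_invK frac_unitK frac_unit_inv_le
  frac_unit_le).
by move=> p q; rewrite -[RHS]frac_unitK frac_unitM !frac_unit_invK.
Qed.

Definition frac_unit : rl_iso M (neg_cone frac_group) :=
  @RlIso M (neg_cone frac_group) (RlHom frac_unit_subproof)
    (RlHom frac_unit_inv_subproof) frac_unitK frac_unit_invK.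

End Fractions.

Section FracMap.
Context (M N : canIGMV) (f : rl_hom M N).
Let Hf := rl_funP f.

Lemma frac_map_subproof (p : frac M) : f (num p) ⊔ f (den p) = 1.
Proof. by rewrite -(rl_hom_join Hf) fracP (rl_hom_one Hf). Qed.

Definition frac_map_fun (p : frac_group M) : frac_group N :=
  exist _ (f (num p), f (den p)) (frac_map_subproof p).

Lemma frac_map_hom : is_lg_hom frac_map_fun.
Proof.
split=> [p q|p q|p q|p|]; apply: frac_eq; rewrite /num /den /=;
  by rewrite ?(rl_hom_rdiv Hf, rl_hom_mul Hf, rl_hom_ldiv Hf, rl_hom_meet Hf,
               rl_hom_join Hf, rl_hom_one Hf).
Qed.

Definition frac_map : lg_hom (frac_group M) (frac_group N) := LgHom frac_map_hom.

End FracMap.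

Section FracCounit.
Local Open Scope lg_scope.
Context (L : lgroup).
Let HL := lgP L.
Let LL := lg_lattice HL.
Let M := neg_cone L.
Let LF := lg_lattice (lgP (frac_group M)).

Definition frac_counit_fun (p : frac_group M) : L :=
  proj1_sig (num p) * (proj1_sig (den p))^-1.

Definition frac_counit_inv (x : L) : frac_group M :=
  norm (neg_part_of x : M) (neg_part_of x^-1).

Lemma frac_counit_norm (x y : M) :
  frac_counit_fun (norm x y) = proj1_sig x * (proj1_sig y)^-1.
Proof.
rewrite /frac_counit_fun /norm /num /den /=.
have -> : proj1_sig y * (proj1_sig x)^-1 = (proj1_sig x * (proj1_sig y)^-1)^-1.
  by rewrite (ginvM HL) (ginvK HL).
exact: (neg_part HL).
Qed.

Lemma frac_counit_invK : cancel frac_counit_inv frac_counit_fun.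
Proof. by move=> x; rewrite /frac_counit_inv frac_counit_norm /= (neg_part HL). Qed.

Lemma frac_counitK : cancel frac_counit_fun frac_counit_inv.
Proof.
move=> p; rewrite -[RHS]norm_frac -[in RHS](norm_frac p) /frac_counit_inv.
congr norm; apply: sub_inj => //=.
by rewrite /frac_counit_fun (ginvM HL) (ginvK HL).
Qed.

Lemma frac_counit_le (p q : frac_group M) :
  p ⊑ q -> frac_counit_fun p ⊑ frac_counit_fun q.
Proof.
move=> /frac_leP [/neg_leP n /neg_leP d].
apply: (le_trans LL) (gmul_le_r HL _ n) _.
by apply: (gmul_le_l HL); apply: (ginv_le HL).
Qed.

Lemma frac_counit_inv_le (x y : L) :
  x ⊑ y -> frac_counit_inv x ⊑ frac_counit_inv y.
Proof.
move=> xy; apply: norm_le; apply/neg_leP; apply: (leI2 LL) => //=;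
  rewrite ?(le_refl LL) //; by [apply: (ginv_le HL) | apply: (le_refl LL)].
Qed.

Lemma frac_counitM (p q : frac_group M) :
  frac_counit_fun (p * q) = frac_counit_fun p * frac_counit_fun q.
Proof.
have [u [v E]] := ore (den p) (num q).
have -> : p * q = norm (num p ⋅ u) (den q ⋅ v) := fmul_frac E.
rewrite frac_counit_norm; move: (congr1 (@proj1_sig _ _) E).
rewrite /frac_counit_fun /=.
move: (proj1_sig (num p)) (proj1_sig (den p)) (proj1_sig (num q))
  (proj1_sig (den q)) (proj1_sig u) (proj1_sig v) => a b c d x y bx.
have -> : c = b * x * y^-1 by rewrite bx (gmulK HL).
by rewrite (ginvM HL) !(gmulA HL) (gmulKv HL).
Qed.

Lemma hom_of_iso (G H : lgroup) (f : G -> H) (g : H -> G) :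
  cancel f g -> cancel g f ->
  (forall x y, x ⊑ y -> f x ⊑ f y) -> (forall x y, x ⊑ y -> g x ⊑ g y) ->
  (forall x y, f (x * y) = f x * f y) -> is_lg_hom f.
Proof.
move=> fK gK f_le g_le fM; have [HG HH] := (lgP G, lgP H).
have [? ?] := order_iso_meet_join (lg_lattice HG) (lg_lattice HH) fK gK f_le g_le.
have f1 : f e = e.
  by rewrite -(gmulVK HH (f e) (f e)) -fM (gmulx1 HG) (gmulVx HH).
by split=> // x; apply: (ginv_uniq HH); rewrite -fM (gmulxV HG).
Qed.

Lemma frac_counit_subproof : is_lg_hom frac_counit_fun.
Proof.
exact: (hom_of_iso frac_counitK frac_counit_invK frac_counit_le
  frac_counit_inv_le frac_counitM).
Qed.

Lemma frac_counit_inv_subproof : is_lg_hom frac_counit_inv.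
Proof.
apply: (hom_of_iso frac_counit_invK frac_counitK frac_counit_inv_le
  frac_counit_le).
by move=> x y; rewrite -[RHS]frac_counitK frac_counitM !frac_counit_invK.
Qed.

Definition frac_counit : lg_iso (frac_group M) L :=
  @LgIso (frac_group M) L (LgHom frac_counit_subproof)
    (LgHom frac_counit_inv_subproof) frac_counitK frac_counit_invK.

End FracCounit.

Definition frac_quasi_inverse : quasi_inverse.
Proof.
refine (@QuasiInverse frac_group frac_map _ _ _ frac_unit _ frac_counit _).
- by move=> M N f g fg p; apply: frac_eq; apply: fg.
- by move=> M p; apply: frac_eq.
- by move=> M N P g f p; apply: frac_eq.
- move=> M N f x; apply: sub_inj; apply: frac_eq => //.
  exact: esym (rl_hom_one (rl_funP f)).
- move=> L G f p; rewrite /= /frac_counit_fun.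
  by rewrite (lg_hom_mul (lg_funP f)) (lg_hom_inv (lg_funP f)).
Defined.

(* Main.v *)
From Stdlib Require Import ssreflect ssrfun ssrbool.
Require Import Defs.

Set Implicit Arguments.
Unset Strict Implicit.
Unset Printing Implicit Defensive.

(** In a perfect pseudo MV-algebra the negation [minus] is an antitone
    bijection from the filter [F A] onto its complement, because [A] is
    involutive and every element [x] outside the filter has [tilde x] inside it.
    Hence [A] consists of two copies of [F A]: the elements [a] and the elements
    [minus a].  The operations of [A] can be read off in these coordinates from
    residuation and involutivity alone.  For instance
    [a ⋅ minus b = minus (b / tilde (tilde a))] and
    [minus a ⋅ b = minus (b \ a)]; the double negation appears when a factor
    from the filter has to move to the other side of a negated one, and this is
    what the twist of the construction [K] records.

    Let [u] identify [F A] with a negative cone [L^-].  Sending [a] to [u a] in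
    the copy of [L^-], and [minus a] to [(u a)^-1] in the copy of [L^+], turns
    each of the coordinate formulas into the corresponding clause of [K],
    provided that [lam] extends the automorphism [tilde2] along [u]
    ([perfect_pMV_iso_K]).  For [L = ell (F A)] this last condition is the
    naturality of the unit of the equivalence. *)

Lemma ginvU (L : lg_ops) (HL : is_lgroup L) (x y : L) :
  ((x ⊔ y)^-1 = x^-1 ⊓ y^-1)%lg.
Proof. by rewrite -[RHS](ginvK HL) (ginvI HL) !(ginvK HL). Qed.

(** * The two copies of the filter *)

Section Coordinates.
Context (A : perfect_pMV).
Let HA := ppmvP A.
Let GA := pmv_igmv HA.
Let RA := int_rl (igmv_int GA).
Let LA := rl_lattice RA.
Implicit Types (x y : A) (a b : F A).

Definition of_filter a : A := proj1_sig a.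

Lemma h_of_filter a : h A (of_filter a) = true.
Proof. exact: proj2_sig a. Qed.

Lemma h_minus_filter a : h A (minus (of_filter a)) = false.
Proof. by rewrite (rl_hom_rdiv (h_rl A)) h_zero h_of_filter. Qed.

Lemma h_tilde x : h A x = false -> h A (tilde x) = true.
Proof. by rewrite (rl_hom_ldiv (h_rl A)) h_zero => ->. Qed.

Lemma filter_cases x :
  {a | x = of_filter a} + {a | x = minus (of_filter a)}.
Proof.
case hx: (h A x); [left | right].
  by exists (exist _ x hx).
by exists (exist _ (tilde x) (h_tilde hx)); rewrite (tildeK HA).
Qed.

Lemma minus_filter_le a b : minus (of_filter a) ⊑ of_filter b.
Proof. exact: perfect_le (h_minus_filter a) (h_of_filter b). Qed.

Lemma minus_filter_inj a b :
  minus (of_filter a) = minus (of_filter b) -> a = b.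
Proof.
move=> E; apply: sub_inj; change (of_filter a = of_filter b).
by rewrite -[LHS](minusK HA) E (minusK HA).
Qed.

Lemma zero_minus_filter : (0 : A) = minus (of_filter 1).
Proof. exact: esym (rdivx1 GA _). Qed.

Lemma meet_filter_minus a b :
  of_filter a ⊓ minus (of_filter b) = minus (of_filter b).
Proof. by rewrite (meetC LA); apply: minus_filter_le. Qed.

Lemma join_filter_minus a b :
  of_filter a ⊔ minus (of_filter b) = of_filter a.
Proof. by rewrite (joinC LA); apply/(le_joinP LA)/minus_filter_le. Qed.

Lemma meet_minus_filter a b :
  minus (of_filter a) ⊓ minus (of_filter b) = minus (of_filter (a ⊔ b)).
Proof. exact: esym (rdivU RA _ _ _). Qed.

Lemma join_minus_filter a b :
  minus (of_filter a) ⊔ minus (of_filter b) = minus (of_filter (a ⊓ b)).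
Proof.
apply: (le_anti LA).
  by apply: (leUx LA); apply: (minus_anti HA); [apply: leIl | apply: leIr].
(* As [minus] is an order anti-isomorphism with inverse [tilde], the join is
   the negation of the meet of the two tildes. *)
rewrite -[X in _ ⊑ X](tildeK HA); apply/(minus_anti HA)/(lexI LA).
  by rewrite -[X in _ ⊑ X](minusK HA); apply/(tilde_anti HA)/(leUl LA).
by rewrite -[X in _ ⊑ X](minusK HA); apply/(tilde_anti HA)/(leUr LA).
Qed.

Lemma mul_filter_minus a b :
  of_filter a ⋅ minus (of_filter b) = minus (of_filter (b / tilde2_fun a)).
Proof.
by rewrite -[LHS](tildeK HA) (tilde_mul HA) (ldiv_tilde HA) (minusK HA).
Qed.

Lemma mul_minus_filter_l a b :
  minus (of_filter a) ⋅ of_filter b = minus (of_filter (b \ a)).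
Proof. by rewrite -[LHS](tildeK HA) (tilde_mul HA) (minusK HA). Qed.

(** The homomorphism onto the two-element algebra only says that the product
    lies outside the filter.  That it is [0] needs the order: [minus a] lies
    below every element of the filter, in particular below [tilde (minus b)]. *)
Lemma mul_minus_minus a b :
  minus (of_filter a) ⋅ minus (of_filter b) = 0.
Proof.
apply: (le_anti LA); last exact: (le_zero (pmv_flw HA)).
apply/(rdivP RA).
exact: (minus_filter_le a (minus2_fun b)).
Qed.

Lemma ldiv_filter_minus a b :
  of_filter a \ minus (of_filter b) = minus (of_filter (b ⋅ tilde2_fun a)).
Proof.
rewrite /minus (ldiv_rdiv RA) (rdiv_mul RA); congr (_ / _).
exact: esym (tildeK HA _).
Qed.

Lemma ldiv_minus_filter a b : minus (of_filter a) \ of_filter b = 1.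
Proof. exact/(ldiv_eq1 GA)/minus_filter_le. Qed.

Lemma ldiv_minus_minus a b :
  minus (of_filter a) \ minus (of_filter b) = of_filter (a / b).
Proof. by rewrite (ldiv_tilde HA) !(minusK HA). Qed.

Lemma rdiv_minus_filter a b :
  minus (of_filter b) / of_filter a = minus (of_filter (a ⋅ b)).
Proof. exact: esym (rdiv_mul RA _ _ _). Qed.

Lemma rdiv_filter_minus a b : of_filter b / minus (of_filter a) = 1.
Proof. exact/(rdiv_eq1 GA)/minus_filter_le. Qed.

Lemma rdiv_minus_minus a b :
  minus (of_filter b) / minus (of_filter a)
    = of_filter (minus2_fun (b \ a)).
Proof.
have -> : minus2_fun (b \ a) = minus2_fun b \ minus2_fun a.
  exact: rl_hom_ldiv (minus2_subproof A) b a.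
by rewrite /of_filter /= (ldiv_tilde HA) !(minusK HA).
Qed.

End Coordinates.

(** * Transport to the two cones *)

Section ToK.
Context (A : perfect_pMV) (L : lgroup) (u : rl_iso (F A) (neg_cone L)).
Context (lam : lg_iso L L).
Hypothesis u_lam : forall a,
  proj1_sig (u (tilde2_fun a)) = lam (proj1_sig (u a)).
Local Notation uval a := (proj1_sig (u a)).
Let HL := lgP L.
Let LL := lg_lattice HL.
Let Hu := rl_funP u.
Implicit Types (x y : A) (a b : F A).

Lemma uval_minus2 a : uval (minus2_fun a) = lg_bwd lam (uval a).
Proof. by rewrite -{2}(minus2_funK a) u_lam lg_fwdK. Qed.

Lemma neg_inv_ge (n : neg L) : (e ⊑ (proj1_sig n)^-1)%lg.
Proof. by case: n => x xe /=; rewrite -(ginv1 HL); apply: (ginv_le HL). Qed.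

Lemma pos_inv_le (p : pos L) : ((proj1_sig p)^-1 ⊑ e)%lg.
Proof. by case: p => x ex /=; rewrite -(ginv1 HL); apply: (ginv_le HL). Qed.

Definition neg_inv (n : neg L) : pos L :=
  exist (fun z => e%lg ⊑ z) _ (neg_inv_ge n).
Definition pos_inv (p : pos L) : neg L :=
  exist (fun z => z ⊑ e%lg) _ (pos_inv_le p).

Definition to_K x : K L lam :=
  match filter_cases x with
  | inl (exist _ a _) => inl (u a)
  | inr (exist _ a _) => inr (neg_inv (u a))
  end.

Definition of_K (k : K L lam) : A :=
  match k with
  | inl n => of_filter (rl_bwd u n)
  | inr p => minus (of_filter (rl_bwd u (pos_inv p)))
  end.

Lemma to_K_filter a : to_K (of_filter a) = inl (u a).
Proof.
rewrite /to_K; case: filter_cases => -[b E].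
  by congr (inl (u _)); apply: sub_inj.
by have := h_minus_filter b; rewrite -E h_of_filter.
Qed.

Lemma to_K_minus a : to_K (minus (of_filter a)) = inr (neg_inv (u a)).
Proof.
rewrite /to_K; case: filter_cases => -[b E].
  by have := h_minus_filter a; rewrite E h_of_filter.
by rewrite (minus_filter_inj E).
Qed.

Lemma to_KK : cancel to_K of_K.
Proof.
move=> x; case: (filter_cases x) => -[a ->].
  by rewrite to_K_filter /= rl_fwdK.
rewrite to_K_minus /=; congr (minus (of_filter _)).
rewrite -[RHS](rl_fwdK u); congr (rl_bwd u _).
by apply: sub_inj; rewrite /= (ginvK HL).
Qed.

Lemma of_KK : cancel of_K to_K.
Proof.
case=> [n|p] /=; first by rewrite to_K_filter rl_bwdK.
rewrite to_K_minus rl_bwdK; congr inr.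
by apply: sub_inj; rewrite /= (ginvK HL).
Qed.

Lemma to_K_one : to_K 1 = 1.
Proof. by rewrite -[1]/(of_filter (one (F A))) to_K_filter (rl_hom_one Hu). Qed.

Lemma to_K_zero : to_K 0 = 0.
Proof.
rewrite zero_minus_filter to_K_minus (rl_hom_one Hu); congr inr.
by apply: sub_inj; apply: (ginv1 HL).
Qed.

Lemma to_K_meet x y : to_K (x ⊓ y) = to_K x ⊓ to_K y.
Proof.
case: (filter_cases x) (filter_cases y) => [[a ->]|[a ->]] [[b ->]|[b ->]].
- rewrite -[_ ⊓ _]/(of_filter (a ⊓ b)).
  by rewrite !to_K_filter (rl_hom_meet Hu).
- by rewrite meet_filter_minus to_K_minus to_K_filter.
- have -> : minus (of_filter a) ⊓ of_filter b = minus (of_filter a).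
    exact: minus_filter_le.
  by rewrite to_K_minus to_K_filter.
- rewrite meet_minus_filter !to_K_minus (rl_hom_join Hu); congr inr.
  by apply: sub_inj; apply: (ginvU HL).
Qed.

Lemma to_K_join x y : to_K (x ⊔ y) = to_K x ⊔ to_K y.
Proof.
have LA := rl_lattice (int_rl (igmv_int (pmv_igmv (ppmvP A)))).
case: (filter_cases x) (filter_cases y) => [[a ->]|[a ->]] [[b ->]|[b ->]].
- rewrite -[_ ⊔ _]/(of_filter (a ⊔ b)).
  by rewrite !to_K_filter (rl_hom_join Hu).
- by rewrite join_filter_minus to_K_minus to_K_filter.
- by rewrite (joinC LA) join_filter_minus to_K_minus to_K_filter.
- rewrite join_minus_filter !to_K_minus (rl_hom_meet Hu); congr inr.
  by apply: sub_inj; apply: (ginvI HL).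
Qed.

Lemma to_K_mul x y : to_K (x ⋅ y) = to_K x ⋅ to_K y.
Proof.
case: (filter_cases x) (filter_cases y) => [[a ->]|[a ->]] [[b ->]|[b ->]].
- rewrite -[_ ⋅ _]/(of_filter (a ⋅ b)).
  by rewrite !to_K_filter (rl_hom_mul Hu).
- rewrite mul_filter_minus !to_K_minus to_K_filter (rl_hom_rdiv Hu).
  congr inr; apply: sub_inj => /=.
  by rewrite u_lam (ginvI HL) (ginvM HL) (ginvK HL) (ginv1 HL).
- rewrite mul_minus_filter_l !to_K_minus to_K_filter (rl_hom_ldiv Hu).
  congr inr; apply: sub_inj => /=.
  by rewrite (ginvI HL) (ginvM HL) (ginvK HL) (ginv1 HL).
- by rewrite mul_minus_minus to_K_zero !to_K_minus.
Qed.

Lemma to_K_ldiv x y : to_K (x \ y) = to_K x \ to_K y.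
Proof.
case: (filter_cases x) (filter_cases y) => [[a ->]|[a ->]] [[b ->]|[b ->]].
- rewrite -[_ \ _]/(of_filter (a \ b)).
  by rewrite !to_K_filter (rl_hom_ldiv Hu).
- rewrite ldiv_filter_minus !to_K_minus to_K_filter (rl_hom_mul Hu).
  congr inr; apply: sub_inj => /=.
  (* The join with [e] in this clause of [K] is vacuous: the product is the
     inverse of an element of the negative cone. *)
  rewrite -u_lam -(ginvM HL) (joinC LL).
  exact/esym/(le_joinP LL)/(neg_inv_ge (negM (u b) (u (tilde2_fun a)))).
- by rewrite ldiv_minus_filter to_K_one to_K_minus to_K_filter.
- rewrite ldiv_minus_minus to_K_filter !to_K_minus (rl_hom_rdiv Hu).
  by congr inl; apply: sub_inj; rewrite /= (ginvK HL).
Qed.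

Lemma to_K_rdiv y x : to_K (y / x) = to_K y / to_K x.
Proof.
case: (filter_cases x) (filter_cases y) => [[a ->]|[a ->]] [[b ->]|[b ->]].
- rewrite -[_ / _]/(of_filter (b / a)).
  by rewrite !to_K_filter (rl_hom_rdiv Hu).
- rewrite rdiv_minus_filter !to_K_minus to_K_filter (rl_hom_mul Hu).
  congr inr; apply: sub_inj => /=.
  rewrite -(ginvM HL) (joinC LL).
  exact/esym/(le_joinP LL)/(neg_inv_ge (negM (u a) (u b))).
- by rewrite rdiv_filter_minus to_K_one to_K_minus to_K_filter.
- have Hl := lg_funP (lg_bwd lam).
  rewrite rdiv_minus_minus to_K_filter !to_K_minus.
  congr inl; apply: sub_inj; rewrite uval_minus2 (rl_hom_ldiv Hu) /=.
  by rewrite (ginvK HL) (lg_hom_meet Hl) (lg_hom_one Hl).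
Qed.

(** Stated for an arbitrary presentation of the filter as a negative cone: the
    functor [ell] enters only through its unit, which supplies such a [u]. *)
Lemma perfect_pMV_iso_K : fl_isomorphic A (K L lam).
Proof.
exists to_K; split; last by exists of_K; [apply: to_KK | apply: of_KK].
split; last exact: to_K_zero.
by split; [apply: to_K_meet | apply: to_K_join | apply: to_K_mul
          |apply: to_K_ldiv | apply: to_K_rdiv | apply: to_K_one].
Qed.

End ToK.

Theorem theorem4 (E : quasi_inverse) (A : perfect_pMV) :
  fl_isomorphic A (K (E (F A)) (ell_approx E A)).
Proof.
apply: (@perfect_pMV_iso_K A _ (ell_unit E (F A))) => a.
exact: (f_equal (@proj1_sig _ _) (ell_unit_nat E (tilde2 A) a)).
Qed.
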